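(* Let $X$ be a finite-dimensional Banach space with $\dim X\ge 2$. If $H(X)=2$, then $X$ is not strictly convex.
   Context: $S_X=\{x\in X:\|x\|=1\}$ denotes the unit sphere of $X$. For a Banach space $X$ with $\dim X\ge 2$, the constant $H(X)$ is defined by $$H(X)=\sup\{\min\{\|x+y\|,\|2x-y\|\}: x,\,y,\,x-y\in S_X\}.$$ A Banach space is strictly convex if every point of its unit sphere is an extreme point of its closed unit ball. *)

(* Defs.v *)
From HB Require Import structures.
From mathcomp Require Import all_boot all_order all_algebra.
From mathcomp Require Import all_classical all_reals all_analysis.

Set Implicit Arguments.
Unset Strict Implicit.
Unset Printing Implicit Defensive.

Import Order.TTheory GRing.Theory Num.Theory.
Import numFieldNormedType.Exports.

Local Open Scope classical_set_scope.
Local Open Scope ring_scope.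

(* [Vector R] is what provides finite dimensionality: a [vectType R] is
   linearly isomorphic to some ['rV[R]_n], and its dimension is [\dim {: X}].
   The norm is arbitrary and unrelated to that isomorphism. *)
#[short(type="finDimBanachType")]
HB.structure Definition FinDimBanach (R : realType) :=
  {X of Vector R X & CompleteNormedModule R X}.

Definition unit_sphere (R : realType) (X : normedModType R) : set X :=
  [set x | `|x| = 1].

Arguments unit_sphere {R} X _.

(* [sup] is a real supremum, totalised by 0 on sets without one. When
   [dim X >= 2] the set below is nonempty and bounded above, so this does
   not interfere. *)
Definition H_const (R : realType) (X : normedModType R) : R :=
  sup [set r | exists x y : X,
    [/\ unit_sphere X x, unit_sphere X y, unit_sphere X (x - y) &
        r = Num.min `|x + y| `|2 *: x - y|]].

Definition extreme_point (R : realType) (X : lmodType R) (A : set X) (x : X) :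
    Prop :=
  A x /\ forall (y z : X) (t : R), A y -> A z -> 0 < t -> t < 1 ->
    x = t *: y + (1 - t) *: z -> y = x /\ z = x.

Definition strictly_convex (R : realType) (X : normedModType R) : Prop :=
  forall x : X, unit_sphere X x -> extreme_point (closed_ball (0 : X) 1) x.

(* Main.v *)
Require Import Defs.
From HB Require Import structures.
From mathcomp Require Import all_boot all_order all_algebra.
From mathcomp Require Import all_classical all_reals all_analysis.

(** The value 2 cannot be a mere limit: compactness produces a pair at which
    strict convexity fails. In finite dimension the unit sphere is compact
    ([compact_unit_sphere]), so among the pairs [x], [y] with [x], [y] and
    [x - y] on the sphere there is one that maximises [`|x + y|]. This maximum
    dominates [H_const X] because it dominates each minimum in the supremum
    ([H_const_le_attained]).
    Hence if [H_const X = 2], then [`|x + y| = 2] for some such pair: the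
    midpoint of [x] and [y] lies on the sphere. Strict convexity would force
    [x = y] ([strictly_convex_midpoint]), whereas [`|x - y| = 1].

    Compactness of the sphere is the classical comparison of norms: the
    coordinate map [r2v] is continuous, and its norm is bounded below by a
    positive constant on the sup-norm sphere, which is compact. So the unit
    sphere is a closed subset of the image under [r2v] of a bounded closed
    set of row vectors. *)

Import Order.TTheory GRing.Theory Num.Theory.
Import numFieldNormedType.Exports.
Import VectorInternalTheory.

Local Open Scope classical_set_scope.
Local Open Scope ring_scope.

Lemma closed_unit_sphere (R : realType) (X : normedModType R) :
  closed (unit_sphere X).
Proof.
apply: (preimage_closed (f := fun x : X => `|x|) (D := [set r : R | r = 1])).
  by move=> x _; exact: norm_continuous.
exact: closed_eq.
Qed.

Lemma r2v_continuous (R : realType) (X : finDimBanachType R) :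
  continuous (r2v : 'rV[R]_(dim X) -> X).
Proof.
have -> : (r2v : 'rV[R]_(dim X) -> X) =
    (fun v => \sum_j v ord0 j *: r2v (delta_mx ord0 j)).
  apply/funext => v; rewrite {1}[v]row_sum_delta linear_sum /=.
  by apply: eq_bigr => j _; rewrite linearZ.
apply: continuous_big => [|j _ v]; first exact: add_continuous.
exact: (@cvgZr_tmp R X _ _ _ _ _ _ (@coord_continuous R 1 (dim X) ord0 j v)).
Qed.

(** The half of the equivalence of norms that compactness needs: the
    coordinates of a vector are bounded by a multiple of its norm. *)
Lemma norm_v2r_le (R : realType) (X : finDimBanachType R) :
  exists M : R, forall x : X, `|v2r x| <= M * `|x|.
Proof.
pose S := unit_sphere 'rV[R]_(dim X).
have Sunit (v : 'rV[R]_(dim X)) : v != 0 -> S (`|v|^-1 *: v).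
  by move=> v0; rewrite /S/unit_sphere/= normrZ normfV normr_id mulVf ?normr_eq0.
(* In dimension 0 there is no vector to minimise over, and every norm is 0. *)
have [S0|/nonemptyPn S0] := pselect (S !=set0); last first.
  exists 0 => x; rewrite mul0r normr_le0; apply/negPn/negP => /Sunit.
  by rewrite S0.
have cS : compact S.
  apply: bounded_closed_compact; last exact: closed_unit_sphere.
  by exists 1; split=> // M M1 v; rewrite /S/unit_sphere/= => ->; exact: ltW.
have cf : {within S, continuous (fun v => `|r2v v : X|)}.
  apply: continuous_subspaceT => v.
  exact: (continuous_comp (r2v_continuous _ _ v) (@norm_continuous _ _ _)).
have [c /set_mem Sc cmin] := @compact_EVT_min _ _ _ _ S0 cS cf.
have m0 : 0 < `|r2v c : X|.
  rewrite normr_gt0; apply/eqP => rc0; move: Sc.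
  rewrite /S/unit_sphere/= -[c]r2vK rc0 linear0 normr0 => /eqP.
  by rewrite eq_sym oner_eq0.
exists `|r2v c : X|^-1 => x.
have [->|x0] := eqVneq (v2r x) 0; first by rewrite normr0 mulr_ge0 ?invr_ge0.
have := cmin _ (mem_set (Sunit _ x0)).
rewrite linearZ/= v2rK normrZ normfV normr_id => h.
by rewrite mulrC ler_pdivlMr// -ler_pdivlMl ?normr_gt0.
Qed.

Lemma compact_unit_sphere (R : realType) (X : finDimBanachType R) :
  compact (unit_sphere X).
Proof.
have [M hM] := norm_v2r_le R X.
pose B : set 'rV[R]_(dim X) := [set v | `|v| <= M].
have cB : compact B.
  apply: bounded_closed_compact.
    exists M; split; first exact: num_real.
    by move=> N MN v /le_trans; apply; exact: ltW.
  apply: (preimage_closed (f := fun v : 'rV[R]_(dim X) => `|v|)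
                          (D := [set r : R | r <= M])).
    by move=> v _; exact: norm_continuous.
  exact: closed_le.
apply: (@subclosed_compact _ _ (r2v @` B)) (closed_unit_sphere R X) _ _.
  by apply: continuous_compact cB; apply/continuous_subspaceT/r2v_continuous.
move=> x x1; exists (v2r x); last exact: v2rK.
by rewrite /B/= (le_trans (hM x))// x1 mulr1.
Qed.

(** By the triangle inequality the midpoint of [x] and [y] is itself a unit
    vector, so it is an extreme point of the ball that is the middle of a
    segment of the ball: the segment has to be degenerate. *)
Lemma strictly_convex_midpoint (R : realType) (X : normedModType R) (x y : X) :
  strictly_convex X -> unit_sphere X x -> unit_sphere X y ->
  2 <= `|x + y| -> x = y.
Proof.
rewrite /unit_sphere/= => scX x1 y1 xy2.
have ball1 (z : X) : `|z| = 1 -> closed_ball (0 : X) 1 z.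
  by move=> z1; rewrite closed_ballE// /closed_ball_/= sub0r normrN z1.
have xy : `|x + y| = 2.
  apply/eqP; rewrite eq_le xy2 andbT.
  by rewrite (le_trans (ler_normD _ _))// x1 y1.
have mid1 : `|2^-1 *: (x + y)| = 1.
  by rewrite normrZ xy ger0_norm ?invr_ge0// mulVf.
have h : 1 - 2^-1 = 2^-1 :> R by rewrite {1}(splitr 1) div1r addrK.
have [_ ext] := scX _ mid1.
have [|||xm ym] := ext x y 2^-1 (ball1 _ x1) (ball1 _ y1).
- by rewrite invr_gt0.
- by rewrite invf_lt1 ?ltr1n.
- by rewrite h scalerDr.
- exact: etrans xm (esym ym).
Qed.

(** Only the first of the two norms under the minimum is maximised, because a
    maximum of either one bounds the supremum of the minima. A nonzero value
    of the constant guarantees that there are admissible pairs at all. *)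
Lemma H_const_le_attained (R : realType) (X : finDimBanachType R) :
  H_const X != 0 ->
  exists x y : X, [/\ unit_sphere X x, unit_sphere X y,
    unit_sphere X (x - y) & H_const X <= `|x + y|].
Proof.
rewrite /H_const; set A := (A in sup A) => H0.
pose K := (unit_sphere X `*` unit_sphere X) `&`
  [set p : X * X | unit_sphere X (p.1 - p.2)].
(* The value of [sup] on the empty set is 0. *)
have A0 : A !=set0.
  by apply/set0P; apply: contra_neq H0 => ->; exact: sup0.
have cK : compact K.
  apply: (@subclosed_compact _ _ (unit_sphere X `*` unit_sphere X)).
  - apply: closedI; first apply: closedI.
    + apply: (preimage_closed (f := fst)); last exact: closed_unit_sphere.
      by move=> p _; exact: cvg_fst.
    + apply: (preimage_closed (f := snd)); last exact: closed_unit_sphere.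
      by move=> p _; exact: cvg_snd.
    apply: (preimage_closed (f := fun p : X * X => p.1 - p.2)); last first.
      exact: closed_unit_sphere.
    by move=> p _; apply: cvgB; [exact: cvg_fst|exact: cvg_snd].
  - by apply: compact_setX; exact: compact_unit_sphere.
  - exact: subIsetl.
have cf : {within K, continuous (fun p : X * X => `|p.1 + p.2|)}.
  apply: continuous_subspaceT => p.
  by apply: cvg_norm; apply: cvgD; [exact: cvg_fst|exact: cvg_snd].
have K0 : K !=set0 by have [_ [u [v [u1 v1 uv1 _]]]] := A0; exists (u, v).
have [[x y] /set_mem[[/= x1 y1] xy1] xymax] := @compact_EVT_max _ _ _ _ K0 cK cf.
exists x, y; split=> //; apply: ge_sup => //.
move=> _ [u [v [u1 v1 uv1 ->]]]; rewrite ge_min; apply/orP; left.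
by apply: (xymax (u, v)); apply/mem_set.
Qed.

Theorem theorem2p2 (R : realType) (X : finDimBanachType R)
    (hdim : (2 <= \dim {: X})%N) (hH : H_const X = 2) :
  ~ strictly_convex X.
Proof.
move=> scX.
have [|x [y [x1 y1 xy1]]] := H_const_le_attained R X; first by rewrite hH.
rewrite hH => /(strictly_convex_midpoint _ _ _ _ scX x1 y1) xy.
by move/eqP: xy1; rewrite xy subrr normr0 eq_sym oner_eq0.
Qed.
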